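(* Let $\mu = -\alpha_{i,r}$ with $1 < i \leq r$ be a negative root of $\mathfrak{sl}_{r+1}(\mathbb{C})$ and let $\tilde\alpha$ be the highest root. The set $\mathrm{BAS}(\tilde\alpha, \mu)$ of basic allowable subwords of $\mathcal{A}(\tilde\alpha, \mu)$ consists of (a) $s_k$ with $1 < k \leq r$, (b) $s_{k+1}s_k$ with $\max(i-1,2) \leq k \leq r-2$, (c) $s_ks_{k+1}$ with $i \leq k \leq r-2$, (d) $s_ks_{k+1}s_k$ with $i \leq k \leq r-2$, and (e) $s_{k+2}s_ks_{k+1}$ with $i \leq k \leq r-3$.
   Context: Type $A_r$: the simple roots are $\alpha_i=e_i-e_{i+1}\in\mathbb{R}^{r+1}$ for $1\le i\le r$; the positive roots are $\alpha_{i,j}=\alpha_i+\alpha_{i+1}+\cdots+\alpha_j$ for $1\le i\le j\le r$; the highest root is $\tilde\alpha=\alpha_1+\cdots+\alpha_r$; $\rho$ is half the sum of the positive roots. The Weyl group $W\cong\mathfrak{S}_{r+1}$ is generated by the simple reflections $s_1,\dots,s_r$, where $s_k$ swaps $e_k$ and $e_{k+1}$. $\wp(\xi)$ is the number of ways of expressing $\xi$ as a linear combination of positive roots with nonnegative integer coefficients, and $\mathcal{A}(\lambda,\mu)=\{\sigma\in W:\wp(\sigma(\lambda+\rho)-\mu-\rho)>0\}$. The influence of $\sigma\in W$ is $I(\sigma)=\{i: s_i\text{ is in a reduced word for }\sigma\}$ and the extended influence is $\overline I(\sigma)=\{i: i\in I(\sigma) \text{ or } i+1\in I(\sigma) \text{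 or } i-1\in I(\sigma)\}$. $I(\sigma)$ is connected if it induces a connected subgraph of the Dynkin diagram (the path $1-2-\cdots-r$), i.e. it is a set of consecutive integers. $\sigma,\tau$ are independent if $I(\sigma)\cap\overline I(\tau)=\emptyset$; a set is pairwise independent if any two distinct elements of it are independent. For $\lambda$ dominant integral and $\mathcal{A}(\lambda,\mu)\neq\emptyset$, $\mathrm{BAS}(\lambda,\mu)$ (the basic allowable subwords) is the unique subset $S\subseteq\mathcal{A}(\lambda,\mu)$ with $1\notin S$ such that each $b\in S$ has connected influence and every $\sigma\in\mathcal{A}(\lambda,\mu)$ is a product of the elements of a (possibly empty) pairwise independent subset of $S$. *)

(* Defs.v *)
From HB Require Import structures.
From mathcomp Require Import all_boot all_order all_algebra all_fingroup.
From mathcomp Require Import finmap.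
From mathcomp Require Import boolp classical_sets cardinality reals.

Set Implicit Arguments.
Unset Strict Implicit.
Unset Printing Implicit Defensive.

Import GRing.Theory Num.Theory.

Local Open Scope ring_scope.
Local Open Scope classical_set_scope.

(* Simple roots, basis vectors and simple reflections are indexed from 1 by
   natural numbers: e_k is meaningful for 1 <= k <= r + 1, while alpha_k and
   s_k are meaningful for 1 <= k <= r. *)

Definition evec (R : realType) (r k : nat) : 'rV[R]_r.+1 :=
  delta_mx 0 (inord k.-1).

Definition simple_root (R : realType) (r k : nat) : 'rV[R]_r.+1 :=
  evec R r k - evec R r k.+1.

(* alpha_{i,j} = alpha_i + ... + alpha_j *)
Definition aroot (R : realType) (r i j : nat) : 'rV[R]_r.+1 :=
  \sum_(i <= k < j.+1) simple_root R r k.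

Definition highest_root (R : realType) (r : nat) : 'rV[R]_r.+1 := aroot R r 1 r.

(* Index set {(i, j) | 1 <= i <= j <= r} of the positive roots alpha_{i,j};
   the bound j <= r comes from the type 'I_r.+1. *)
Definition posroot (r : nat) : finType :=
  {p : 'I_r.+1 * 'I_r.+1 | (1 <= p.1 <= p.2)%N}.

Definition root_of (R : realType) (r : nat) (p : posroot r) : 'rV[R]_r.+1 :=
  aroot R r (val p).1 (val p).2.

Definition rho (R : realType) (r : nat) : 'rV[R]_r.+1 :=
  2^-1 *: \sum_(p : posroot r) root_of R p.

(* The number of families of multiplicities (c_p)_p with
   xi = \sum_p c_p alpha_p.  The set of such families is always finite, so
   that fset_set takes no default value here. *)
Definition kostant (R : realType) (r : nat) (xi : 'rV[R]_r.+1) : nat :=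
  #|` fset_set [set c : {ffun posroot r -> nat} |
        xi = (\sum_(p : posroot r) root_of R p *+ c p)%R]%classic |%fset.

Definition sref (r k : nat) : 'S_r.+1 := tperm (inord k.-1) (inord k).

(* The linear action with sigma (e_j) = e_{sigma j}, that is,
   (sigma v)_j = v_{sigma^-1 j}. *)
Definition wact (R : realType) (r : nat) (s : 'S_r.+1) (v : 'rV[R]_r.+1) :
  'rV[R]_r.+1 := col_perm s^-1%g v.

(* The product of the permutation group is the left-to-right one,
   (s * t) x = t (s x), whereas words in the simple reflections denote
   compositions of linear maps: wmul s t acts by t first. *)
Definition wmul (r : nat) (s t : 'S_r.+1) : 'S_r.+1 := (t * s)%g.

(* s_{k_1} s_{k_2} ... s_{k_m} *)
Definition word (r : nat) (w : seq nat) : 'S_r.+1 :=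
  foldr (fun k t => wmul (sref r k) t) 1%g w.

Definition expresses (r : nat) (w : seq nat) (s : 'S_r.+1) : Prop :=
  all (fun k => (1 <= k <= r)%N) w /\ word r w = s.

Definition reduced_word (r : nat) (w : seq nat) (s : 'S_r.+1) : Prop :=
  expresses w s /\ forall w', expresses w' s -> (size w <= size w')%N.

Definition alternation (R : realType) (r : nat) (lambda mu : 'rV[R]_r.+1) :
  set 'S_r.+1 :=
  [set s | (0 < kostant (wact s (lambda + rho R r) - mu - rho R r))%N].

Definition influence (r : nat) (s : 'S_r.+1) : set nat :=
  [set i | exists w, reduced_word w s /\ i \in w].

Definition ext_influence (r : nat) (s : 'S_r.+1) : set nat :=
  [set i | (1 <= i <= r)%N /\
     (influence s i \/ influence s i.+1 \/ influence s i.-1)].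

(* Adjacency in the Dynkin diagram 1 - 2 - ... - r *)
Definition dynkin_adj : rel nat := fun i j => (i.+1 == j) || (j.+1 == i).

(* The subgraph of the Dynkin diagram induced by I is connected. *)
Definition dynkin_connected (I : set nat) : Prop :=
  forall i j, I i -> I j ->
    exists p : seq nat, [/\ path dynkin_adj i p, last i p = j &
                            forall k, k \in p -> I k].

Definition independent (r : nat) (s t : 'S_r.+1) : Prop :=
  influence s `&` ext_influence t = set0.

Definition pairwise_independent (r : nat) (T : {set 'S_r.+1}) : Prop :=
  forall s t, s \in T -> t \in T -> s != t -> independent s t.

(* S = BAS(lambda, mu).  Pairwise independent elements commute, hence the
   order of the factors in the product is irrelevant. *)
Definition is_BAS (R : realType) (r : nat) (lambda mu : 'rV[R]_r.+1)
    (S : set 'S_r.+1) : Prop :=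
  [/\ S `<=` alternation lambda mu,
      ~ S 1%g,
      forall b, S b -> dynkin_connected (influence b) &
      forall s, alternation lambda mu s ->
        exists T : {set 'S_r.+1},
          [/\ [set` T] `<=` S, pairwise_independent T &
              s = (\prod_(b in T) b)%g]].

(* Main.v *)
Require Import Defs.
From mathcomp Require Import all_boot all_order all_algebra all_fingroup.
From mathcomp Require Import finmap zify ring lra.
From mathcomp Require Import boolp classical_sets cardinality reals.

Set Implicit Arguments.
Unset Strict Implicit.
Unset Printing Implicit Defensive.

Import Order.TTheory GRing.Theory Num.Theory.

(** Put the points 0, ..., r in place of the indices 1, ..., r + 1 and write the
    inverse of sigma in one-line notation.  Its [excess] at k is the sum over the
    points p < k of sigma^-1 p - p.  Everything in the statement can be read off
    this sequence of natural numbers.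

    The excess at k vanishes exactly when sigma stabilises the initial segment of
    length k.  In a reduced word every letter k raises the excess at k strictly
    and keeps the zeros at all other places, so the influence of sigma is the
    support of its excess ([influenceE]).  The exchange property ([exchange]) is
    what makes every step of a reduced word ascending.

    A vector is a nonnegative integral combination of positive roots iff its
    partial sums are nonnegative integers with last one 0 ([kostant_gt0]).  The
    partial sums of sigma(lambda + rho) - mu - rho are, up to the contributions
    of the first and the last basis vector and of mu, minus the excess.  Hence
    sigma is in the alternation set iff its excess is 0 at 1, at most 1 at k < i,
    at most 2 at k >= i, and at r is either 0, or 1 with a 0 at r - 1
    ([alternationE]).  This condition is inherited by any permutation with a
    smaller excess.

    Where the excess vanishes a permutation splits as a product of two
    permutations on disjoint segments; so it is the product of its blocks, which
    are pairwise independent, of connected influence, and of excess bounded by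
    that of the permutation ([decomposition]).  Thus the connected elements other
    than 1 of a set defined by a condition that passes to smaller excesses are
    its basic allowable subwords ([BAS_downward_closed]), and a connected product
    of pairwise independent elements is one of its factors ([connected_prod]),
    which gives uniqueness ([BAS_sub]).

    It remains to list the connected allowable permutations.  A block that starts
    at the letter k has a first value of excess 1 or 2, and the next values are
    forced by injectivity and by the bound 2: the only profiles are 1; 1,2; 2,1;
    2,2 and 2,1,2 ([allowable_convex_basic]), and the five families of words
    realise them.  As the excess determines the permutation, the list is
    complete. *)

(** * Excess of a permutation over initial segments *)

Section Excess.
Variable r : nat.
Implicit Types s t : 'S_r.+1.
Local Open Scope nat_scope.

(** One-line notation of the inverse, extended to natural numbers: the weight
    sigma v has coordinates v_(sigma^-1 p). *)
Definition oneline s (p : nat) : nat := (s^-1)%g (inord p).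

(** The truncated subtraction loses nothing: the subtracted sum is the smaller
    one by [initial_sum_excess]. *)
Definition excess s (k : nat) : nat :=
  \sum_(p < r.+1 | p < k) (s^-1)%g p - \sum_(p < r.+1 | p < k) p.

Lemma oneline_inj s p q :
  p <= r -> q <= r -> oneline s p = oneline s q -> p = q.
Proof.
move=> pr qr /val_inj /perm_inj /(congr1 val) /=.
by rewrite !inordK.
Qed.

Lemma oneline_ext s t : (forall p, p <= r -> oneline s p = oneline t p) -> s = t.
Proof.
move=> e; apply/invg_inj/permP => x; apply: val_inj.
have := e x; rewrite -ltnS ltn_ord => /(_ isT).
by rewrite /oneline inord_val.
Qed.

Lemma initial_sum_ltnS k (F : 'I_r.+1 -> nat) : k <= r ->
  \sum_(p < r.+1 | p < k.+1) F p = \sum_(p < r.+1 | p < k) F p + F (inord k).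
Proof.
move=> kr; rewrite (bigD1 (inord k)) /= ?inordK // addnC; congr (_ + _).
apply: eq_bigl => p; rewrite ltnS -val_eqE /= inordK //.
by rewrite [p < k]ltn_neqAle andbC.
Qed.

Definition stable k : {set 'S_r.+1} :=
  ('N([set p : 'I_r.+1 | p < k] | 'P))%g.

Lemma stableP k s :
  reflect (forall p : 'I_r.+1, (s p < k) = (p < k)) (s \in stable k).
Proof.
apply: (iffP astabsP) => h p; have := h p; rewrite ?inE; [done|].
by move=> ->.
Qed.

(** With A the initial segment and B its image, the elements of B outside A are
    at least k, while the equally many elements of A outside B are below k; so the
    sum over B exceeds the sum over A as soon as A and B differ. *)
Lemma initial_sum_excess s k :
  \sum_(p < r.+1 | p < k) p + (s^-1 \notin stable k)%g
  <= \sum_(p < r.+1 | p < k) (s^-1)%g p.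
Proof.
set t := (s^-1)%g.
pose A := [set p : 'I_r.+1 | p < k]; pose B := t @: A.
have cAB : #|A :\: B| = #|B :\: A|.
  have cB : #|B| = #|A| by rewrite card_imset //; apply: perm_inj.
  by apply: (@addnI #|A :&: B|); rewrite cardsID -cB -(cardsID A B) finset.setIC.
have -> : \sum_(p < r.+1 | p < k) p = \sum_(p in A) p.
  by apply: eq_bigl => p; rewrite inE.
have -> : \sum_(p < r.+1 | p < k) t p = \sum_(p in B) p.
  rewrite /B big_imset /=; last by move=> x y _ _; apply: perm_inj.
  by apply: eq_bigl => p; rewrite inE.
rewrite (big_setID B) [X in _ <= X](big_setID A) /= finset.setIC.
have low : \sum_(p in A :\: B) p + #|A :\: B| <= k * #|A :\: B|.
  rewrite -[X in _ + X]sum1_card -big_split /= mulnC -sum_nat_const.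
  by apply: leq_sum => p; rewrite !inE addn1 => /andP[].
have high : k * #|A :\: B| <= \sum_(p in B :\: A) p.
  rewrite cAB mulnC -sum_nat_const.
  by apply: leq_sum => p; rewrite !inE -leqNgt => /andP[].
have c0 : t \notin stable k -> 0 < #|A :\: B|.
  apply: contraR; rewrite lt0n negbK cards_eq0 finset.setD_eq0 => AB.
  have eAB : A = B.
    by apply/eqP; rewrite eqEcard AB (card_imset _ (@perm_inj _ t)) leqnn.
  apply/stableP => p; have : (t p \in B) = (p \in A).
    by rewrite mem_imset //; apply: perm_inj.
  by rewrite -eAB !inE.
rewrite -addnA leq_add2l; apply: leq_trans high; apply: leq_trans low.
by rewrite leq_add2l; case: (t \notin stable k) c0 => [->|].

Qed.

(** The recurrence by which the excess and the one-line notation determine each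
    other. *)
Lemma excessS s k : k <= r -> excess s k.+1 + k = excess s k + oneline s k.
Proof.
move=> kr; have := initial_sum_excess s k; have := initial_sum_excess s k.+1.
by rewrite /excess !initial_sum_ltnS // /oneline inordK //; lia.
Qed.

Lemma excess0 s : excess s 0 = 0.
Proof. by rewrite /excess !big_pred0. Qed.

Lemma excess_out s k : r < k -> excess s k = 0.
Proof.
move=> rk; rewrite /excess.
rewrite [X in X - _](_ : _ = \sum_(p < r.+1) (s^-1)%g p); last first.
  by apply: eq_bigl => p; rewrite (leq_trans (ltn_ord p)).
rewrite [X in _ - X](_ : _ = \sum_(p < r.+1) p); last first.
  by apply: eq_bigl => p; rewrite (leq_trans (ltn_ord p)).
by rewrite [X in _ - X](reindex_inj (@perm_inj _ (s^-1)%g)) subnn.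
Qed.

Lemma excess_eq0 s k : (excess s k == 0) = (s \in stable k).
Proof.
apply/idP/idP => [|sk].
  rewrite /excess subn_eq0 -groupV => h; move: (initial_sum_excess s k).
  by case: (_ \in _) => //; rewrite addn1 ltnNge h.
rewrite -groupV in sk; have /stableP h := sk.
rewrite /excess [X in _ - X](reindex_inj (@perm_inj _ (s^-1)%g)) /=.
by rewrite (eq_bigl (fun p : 'I_r.+1 => p < k) _ h) subnn.
Qed.

Lemma excess_ext s t j k : j <= k -> excess s j = excess t j ->
  (forall p, j <= p < k -> p <= r -> oneline s p = oneline t p) ->
  excess s k = excess t k.
Proof.
elim: k => [|k IH]; first by rewrite leqn0 => /eqP ->.
rewrite leq_eqVlt => /orP[/eqP-> //|jk ej e].
have [rk|kr] := ltnP r k; first by rewrite !excess_out; lia.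
have ek := e k; have {IH ej e} : excess s k = excess t k.
  by apply: IH => // p hp; apply: e; lia.
by have := excessS s kr; have := excessS t kr; rewrite ek //; lia.
Qed.

Lemma excess1 k : excess 1%g k = 0.
Proof. by apply/eqP; rewrite excess_eq0 group1. Qed.

Lemma oneline1 p : p <= r -> oneline 1%g p = p.
Proof. by move=> pr; rewrite /oneline invg1 perm1 inordK. Qed.

Lemma excess_fixed s j k : j <= k -> excess s j = 0 ->
  (forall p, j <= p < k -> p <= r -> oneline s p = p) -> excess s k = 0.
Proof.
move=> jk sj fx; rewrite -(excess1 k); apply: (excess_ext jk); rewrite ?excess1 //.
by move=> p hp pr; rewrite oneline1 // fx.
Qed.

Lemma oneline_fixed s k :
  k <= r -> excess s k = 0 -> excess s k.+1 = 0 -> oneline s k = k.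
Proof. by move=> kr e0 e1; have := excessS s kr; lia. Qed.

Lemma oneline_ge s k p :
  excess s k = 0 -> k <= p <= r -> k <= oneline s p.
Proof.
move=> /eqP; rewrite excess_eq0 -groupV => /stableP h /andP[kp pr].
by rewrite /oneline leqNgt h inordK // -leqNgt.
Qed.

End Excess.

(** * Reduced words and influence *)

Section Influence.
Variable r : nat.
Implicit Types (s t : 'S_r.+1) (u w : seq nat).
Local Open Scope nat_scope.

Definition swap (k p : nat) : nat :=
  if p == k.-1 then k else if p == k then k.-1 else p.

Definition letters w := all (fun k => 1 <= k <= r) w.

Lemma sref_val k (p : 'I_r.+1) : 0 < k <= r -> sref r k p = swap k p :> nat.
Proof.
move=> /andP[k0 kr]; rewrite /sref /swap.
have kr' : k.-1 < r.+1 by lia.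
case: tpermP => [->|->|]; rewrite ?inordK // ?eqxx //.
  by case: eqP => // ?; lia.
move=> /eqP a /eqP b; move: a b; rewrite -!val_eqE /= !inordK //.
by move=> /negPf -> /negPf ->.
Qed.

Lemma word_cat u w : word r (u ++ w) = (word r w * word r u)%g.
Proof.
elim: u => [|k u IH] /=; first by rewrite mulg1.
by rewrite /wmul IH mulgA.
Qed.

Lemma oneline_word_cons k u p : 0 < k <= r -> p <= r ->
  oneline (word r (k :: u)) p = oneline (word r u) (swap k p).
Proof.
move=> kr pr; rewrite /oneline /= /wmul invMg permM {1}/sref tpermV.
by rewrite -/(sref r k) -{2}(inordK (n' := r) pr) -sref_val // inord_val.
Qed.

Lemma sref_stable j k : 0 < k <= r -> j != k -> sref r k \in stable r j.
Proof.
by move=> kr jk; apply/stableP => p; rewrite sref_val // /swap; do ![case: eqP => ?]; lia.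
Qed.

(** A simple reflection s_k stabilises every initial segment but the one of
    length k, so a letter k cannot create or destroy zeros elsewhere. *)
Lemma excess_cons_neq k u j : 0 < k <= r -> j != k ->
  (excess (word r (k :: u)) j != 0) = (excess (word r u) j != 0).
Proof.
by move=> kr jk; rewrite !excess_eq0 /= /wmul groupMr // sref_stable.
Qed.

(** Prefixing k exchanges the values at k - 1 and k, and only the first of them is
    counted at k: the excess at k grows by their difference. *)
Lemma excess_cons_eq k u : 0 < k <= r ->
  excess (word r (k :: u)) k + oneline (word r u) k.-1 =
  excess (word r u) k + oneline (word r u) k.
Proof.
case: k => // k kr; have kr' : k <= r by lia.
have := excessS (word r (k.+1 :: u)) kr'; have := excessS (word r u) kr'.
rewrite oneline_word_cons // /swap /= eqxx.
rewrite (@excess_ext _ (word r (k.+1 :: u)) (word r u) 0 k) ?excess0 //;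
  first by lia.
move=> p pk pr; rewrite oneline_word_cons //.
by rewrite /swap /=; case: eqP => [|_]; [|case: eqP]; lia.
Qed.

(** The exchange property.  If the pair (k - 1, k) is inverted by the inverse of
    the word, some letter j inverts it; at that moment the pair is (j - 1, j),
    hence s_k is conjugate to s_j by the letters in between, and both cancel. *)
Lemma exchange k u : 0 < k <= r -> letters u ->
  oneline (word r u) k < oneline (word r u) k.-1 ->
  exists u', [/\ letters u', size u' < size u & word r u' = word r (k :: u)].
Proof.
move=> kr; elim/last_ind: u => [|u j IH].
  by move=> _; rewrite !oneline1; lia.
rewrite {1}/letters all_rcons -/(letters u) => /andP[jr lu].
have wE : word r (rcons u j) = (sref r j * word r u)%g.
  by rewrite -cats1 word_cat /= /wmul mul1g.
have oE p : p <= r ->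
    oneline (word r (rcons u j)) p = swap j (oneline (word r u) p).
  move=> pr; rewrite /oneline wE invMg permM {1}/sref tpermV.
  by rewrite -/(sref r j) sref_val.
rewrite !oE; [|lia|lia].
case: (ltngtP (oneline (word r u) k) (oneline (word r u) k.-1)).
- move=> /(IH lu)[u' [lu' su' wu']] _; exists (rcons u' j).
  rewrite /letters all_rcons jr -/(letters u') lu' !size_rcons ltnS su'; split => //.
  rewrite -cats1 word_cat wu' /= /wmul wE mul1g.
  by rewrite mulgA.
- move=> lt; rewrite /swap => sw.
  have [e1 e2] : oneline (word r u) k.-1 = j.-1 /\ oneline (word r u) k = j.
    by move: sw; do ![case: eqP]; lia.
  exists u; rewrite lu size_rcons; split => //=.
  rewrite /wmul wE.
  have e : (sref r k ^ (word r u)^-1)%g = sref r j.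
    rewrite /sref tpermJ; congr tperm; apply: val_inj => /=.
      by rewrite -/(oneline _ _) e1 inordK; lia.
    by rewrite -/(oneline _ _) e2 inordK; lia.
  have comm : (word r u * sref r k = sref r j * word r u)%g.
    by rewrite -e conjgE invgK mulgA mulgKV.
  by rewrite -mulgA comm mulgA /sref tperm2 mul1g.
- by move=> /oneline_inj; lia.
Qed.

(** Each letter of a reduced word makes an ascent into a descent, for otherwise
    the exchange property would give a shorter word. *)
Lemma reduced_tail k u s : reduced_word (k :: u) s ->
  [/\ 0 < k <= r, reduced_word u (word r u) &
      oneline (word r u) k.-1 < oneline (word r u) k].
Proof.
move=> [[/= /andP[kr lu] <-] min]; split=> //.
  split=> // w [lw ww]; rewrite -ltnS; apply: (min (k :: w)).
  by split; [rewrite /= kr|rewrite /= ww].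
rewrite ltnNge leq_eqVlt; apply/negP => /orP[/eqP/oneline_inj|]; first by lia.
move=> /(exchange kr lu)[u' [lu' su' wu']].
by have /= := min u' (conj lu' wu'); lia.
Qed.

(** By [excess_cons_eq] a letter of a reduced word makes the excess at it
    positive, and by [excess_cons_neq] the other letters cannot undo this. *)
Lemma mem_reduced w s k : reduced_word w s -> (k \in w) = (excess s k != 0).
Proof.
elim: w s => [|j u IH] s red.
  have [[_ <-] _] := red; rewrite in_nil; apply/esym/negbF.
  by rewrite excess1.
have [jr redu asc] := reduced_tail red; have [[_ <-] _] := red.
rewrite in_cons (IH _ redu); have [->|kj] := eqVneq k j.
  by have := excess_cons_eq u jr; lia.
by rewrite excess_cons_neq.
Qed.

(** Every permutation is a product of transpositions, and a transposition of
    points at distance d + 2 is conjugate by a simple reflection to one of points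
    at distance d + 1. *)
Lemma ex_word s : exists2 w, letters w & word r w = s.
Proof.
have wM s1 s2 : (exists2 w, letters w & word r w = s1) ->
    (exists2 w, letters w & word r w = s2) ->
    exists2 w, letters w & word r w = (s1 * s2)%g.
  move=> [w1 l1 <-] [w2 l2 <-]; exists (w2 ++ w1); last by rewrite word_cat.
  by rewrite /letters all_cat; apply/andP.
have wS k : 0 < k <= r -> exists2 w, letters w & word r w = sref r k.
  move=> kr; exists [:: k]; first by rewrite /letters /= kr.
  by rewrite /= /wmul mul1g.
have wT d a : a + d.+1 <= r ->
    exists2 w, letters w & word r w = tperm (inord a) (inord (a + d.+1)).
  elim: d => [|d IH] ar; first by rewrite addn1; apply: (wS a.+1); lia.
  have adE : (sref r (a + d.+2)) = tperm (inord (a + d.+1)) (inord (a + d.+2)).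
    by rewrite /sref addnS.
  have -> : tperm (inord a) (inord (a + d.+2)) =
      (sref r (a + d.+2) * tperm (inord a) (inord (a + d.+1)) *
       sref r (a + d.+2))%g :> 'S_r.+1.
    have -> : tperm (inord a) (inord (a + d.+2)) =
      (tperm (inord a) (inord (a + d.+1)) ^ sref r (a + d.+2))%g :> 'S_r.+1.
      rewrite tpermJ adE tpermL tpermD //.
        by rewrite -val_eqE /= !inordK; lia.
      by rewrite -val_eqE /= !inordK; lia.
    by rewrite conjgE {1}/sref tpermV mulgA.
  by apply/wM; [apply/wM|]; [apply/wS; lia|apply/IH; lia|apply/wS; lia].
have [ts -> _] := prod_tpermP s.
elim: ts => [|[x y] ts IH]; first by exists [::]; rewrite ?big_nil.
rewrite big_cons; apply/wM => //=.
have wxy (a b : 'I_r.+1) : a < b -> exists2 w, letters w & word r w = tperm a b.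
  move=> ab; rewrite -[a]inord_val -[b]inord_val.
  have -> : nat_of_ord b = a + (b - a).-1.+1 by lia.
  by apply: wT; have := ltn_ord b; lia.
case: (ltngtP x y) => [/wxy//|/wxy|/val_inj ->].
  by rewrite tpermC.
by rewrite tperm1; exists [::].
Qed.

Lemma ex_reduced s : exists w, reduced_word w s.
Proof.
have [w0 lw0 ww0] := ex_word s.
pose P n := `[< exists2 w, expresses w s & size w = n >].
have exP : exists n, P n by exists (size w0); apply/asboolP; exists w0.
case: (ex_minnP exP) => n /asboolP[w ws <-] min; exists w; split=> // w' w's.
by apply: min; apply/asboolP; exists w'.
Qed.

Lemma influenceE s k : influence s k <-> excess s k != 0.
Proof.
split=> [[w [red kw]]|e]; first by rewrite -(mem_reduced k red).
by have [w red] := ex_reduced s; exists w; rewrite (mem_reduced k red).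
Qed.

End Influence.

(** * Independence and decomposition into blocks *)

Section Decomposition.
Variable r : nat.
Implicit Types (s t b : 'S_r.+1) (T : {set 'S_r.+1}).
Local Open Scope nat_scope.

Lemma excess_range s k : excess s k != 0 -> 0 < k <= r.
Proof.
case: k => [|k]; first by rewrite excess0.
by have [rk|//] := ltnP r k.+1; rewrite excess_out.
Qed.

Lemma independentP s t : independent s t <->
  forall j k, excess s j != 0 -> excess t k != 0 -> (j.+1 < k) || (k.+1 < j).
Proof.
split=> [ind j k sj tk|far].
  apply: contrapT => near; suff: set0 j by [].
  rewrite -ind; split; first exact/influenceE.
  split; first exact: excess_range sj.
  have : [|| k == j, k == j.+1 | k == j.-1] by have := excess_range sj; lia.
  by move=> /or3P[]/eqP kE; [left|right; left|right; right];
    rewrite -kE; apply/influenceE.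
apply/seteqP; split=> // j [/influenceE sj [jr adj]].
by case: adj => [|[]] /influenceE /(far _ _ sj); lia.
Qed.

Lemma excess_fix s (p : 'I_r.+1) : excess s p = 0 -> excess s p.+1 = 0 -> s p = p.
Proof.
move=> e0 e1; have pr : p <= r by rewrite -ltnS.
have := oneline_fixed pr e0 e1; rewrite /oneline inord_val => /val_inj h.
by rewrite -[in LHS]h permKV.
Qed.

(** A moved point p touches the letter p or p + 1 of the influence, so two
    permutations moving p have equal or adjacent letters. *)
Lemma independent_fix s t (p : 'I_r.+1) : independent s t -> s p != p -> t p = p.
Proof.
move=> /independentP far sp.
have [j jp sj] : exists2 j : nat, (j == p :> nat) || (j == p.+1) & excess s j != 0.
  have [e0|?] := eqVneq (excess s p) 0; last by exists p; rewrite ?eqxx.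
  have [e1|?] := eqVneq (excess s p.+1) 0; last by exists p.+1; rewrite ?eqxx ?orbT.
  by rewrite excess_fix ?eqxx in sp.
by apply: excess_fix; apply/eqP; apply: contraT => /(far _ _ sj); lia.
Qed.

Lemma prod_fix T (p : 'I_r.+1) :
  (forall t, t \in T -> t p = p) -> (\prod_(t in T) t)%g p = p.
Proof.
move=> fx; apply: (big_ind (fun x : 'S_r.+1 => x p = p)) => //.
  by rewrite perm1.
by move=> x y xp yp; rewrite permM xp yp.
Qed.

(** Independent permutations have disjoint supports, so only the factor t acts on
    the points that t moves, wherever t stands in the product. *)
Lemma prod_moved T t (p : 'I_r.+1) : pairwise_independent T ->
  t \in T -> t p != p -> (\prod_(u in T) u)%g p = t p.
Proof.
move=> ind tT tp; rewrite -big_filter.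
have fx u : u \in T -> u != t -> forall q : 'I_r.+1, t q != q -> u q = q.
  by move=> uT ut q; apply: independent_fix; apply: ind; rewrite // eq_sym.
have tp' : t (t p) != t p by rewrite (inj_eq perm_inj).
set L := [seq _ <- _ | _].
have : {subset L <= T} by move=> u; rewrite mem_filter => /andP[].
have : t \in L by rewrite mem_filter tT mem_index_enum.
have : uniq L by apply/filter_uniq/index_enum_uniq.
elim: L => //= a L IH /andP[aL uL].
have fxL q : t q != q -> t \notin L -> {subset L <= T} ->
    (\prod_(u <- L) u)%g q = q.
  move=> tq tL sL; rewrite big_seq.
  apply: (big_ind (fun x : 'S_r.+1 => x q = q)) => [|x y xp yp|u uL'].
  - by rewrite perm1.
  - by rewrite permM xp yp.
  - by apply: fx => //; [apply: sL|apply: contraNneq tL => <-].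
rewrite in_cons => /orP[/eqP ta|tL] sL; rewrite big_cons permM.
  rewrite -ta fxL //; first by rewrite ta.
  by move=> u uL'; apply: sL; rewrite in_cons uL' orbT.
rewrite (fx a) ?IH //.
- by move=> u uL'; apply: sL; rewrite in_cons uL' orbT.
- by apply: sL; rewrite mem_head.
- by apply: contraNneq aL => ->.
Qed.

Lemma eq_prod_independent T s : pairwise_independent T ->
  (forall p : 'I_r.+1, (exists2 t, t \in T & t p != p /\ s p = t p) \/
     (s p = p /\ forall t, t \in T -> t p = p)) ->
  s = (\prod_(t in T) t)%g.
Proof.
move=> ind glue; apply/permP => p.
have [[t tT [tp ->]]|[-> fx]] := glue p; first by rewrite (prod_moved ind tT).
by rewrite prod_fix.
Qed.

Lemma excess_prod T k : pairwise_independent T ->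
  (excess (\prod_(t in T) t)%g k != 0) <->
  (exists2 t, t \in T & excess t k != 0).
Proof.
move=> ind; split=> [nz|[t tT]].
  apply: contrapT => none; move: nz; rewrite excess_eq0 => /negP; apply.
  apply: group_prod => t tT; rewrite -excess_eq0; apply: contraT => tk.
  by case: none; exists t.
apply: contraNneq => /eqP; rewrite !excess_eq0 => /stableP h; apply/stableP => p.
have [->//|tp] := eqVneq (t p) p.
by rewrite -(prod_moved ind tT tp).
Qed.

Lemma ex_excess s : s != 1%g -> exists k, excess s k != 0.
Proof.
move=> s1; apply: contrapT => none; move/eqP: s1; apply.
have z k : excess s k = 0 by apply/eqP; apply: contraT => ?; case: none; exists k.
by apply/permP => p; rewrite perm1 excess_fix.
Qed.

(** The influence of the product is the union of the influences of the factors,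
    and no letter of one factor is equal or adjacent to a letter of another.  A
    path in the union therefore stays in the influence of a single factor, so
    there is only one factor. *)
Lemma connected_prod T : pairwise_independent T ->
  1%g \notin T -> (\prod_(t in T) t)%g != 1%g ->
  dynkin_connected (influence (\prod_(t in T) t)%g) ->
  (\prod_(t in T) t)%g \in T.
Proof.
move=> ind T1 nz con.
have [T0|[t tT]] := set_0Vmem T; first by rewrite T0 big_set0 eqxx in nz.
suff -> : T = [set t]%SET by rewrite big_set1 inE.
apply/setP => u; rewrite inE; apply/idP/eqP => [uT|->//].
apply: contrapT => /eqP ut.
have nt v : v \in T -> v != 1%g by apply: contraTneq => ->.
have [a ta] := ex_excess (nt _ tT); have [c uc] := ex_excess (nt _ uT).
have infl v k : v \in T -> excess v k != 0 -> influence (\prod_(t in T) t)%g k.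
  by move=> vT vk; apply/influenceE/excess_prod => //; exists v.
have [p [pth lst sub]] := con a c (infl _ _ tT ta) (infl _ _ uT uc).
have tc : excess t c != 0.
  rewrite -lst; elim: p a ta pth {lst} sub => //= x p IH a ta /andP[ax px] sub.
  apply: IH => //; last by move=> y yp; apply: sub; rewrite in_cons yp orbT.
  have /influenceE/(excess_prod x ind)[v vT vx] := sub x (mem_head _ _).
  have [<-//|vt] := eqVneq v t; have /independentP/(_ _ _ vx ta) := ind _ _ vT tT vt.
  by move: ax; rewrite /dynkin_adj; lia.
by have /independentP/(_ _ _ uc tc) := ind _ _ uT tT ut; lia.
Qed.

Definition convex_influence s := forall j k l, j <= k <= l ->
  excess s j != 0 -> excess s l != 0 -> excess s k != 0.

Lemma convex_connected s : convex_influence s -> dynkin_connected (influence s).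
Proof.
move=> cvx.
have up d a : excess s a != 0 -> excess s (a + d) != 0 ->
    exists p : seq nat, [/\ path dynkin_adj a p, last a p = a + d &
                            forall k, k \in p -> influence s k].
  elim: d a => [|d IH] a sa sad; first by exists [::]; rewrite addn0.
  have sa1 : excess s a.+1 != 0 by apply: (cvx a _ (a + d.+1)) => //; lia.
  have [|p [pth lst sub]] := IH a.+1 sa1; first by rewrite addSnnS.
  exists (a.+1 :: p); rewrite /= lst /dynkin_adj eqxx pth addSnnS; split=> // k.
  by rewrite in_cons => /orP[/eqP->|/sub //]; apply/influenceE.
have down d a : excess s a != 0 -> excess s (a + d) != 0 ->
    exists p : seq nat, [/\ path dynkin_adj (a + d) p, last (a + d) p = a &
                            forall k, k \in p -> influence s k].
  elim: d => [|d IH] sa sad; first by exists [::]; rewrite addn0.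
  have sad' : excess s (a + d) != 0 by apply: (cvx a _ (a + d.+1)) => //; lia.
  have [p [pth lst sub]] := IH sa sad'.
  exists (a + d :: p); rewrite /= lst pth /dynkin_adj addnS eqxx orbT.
  split=> // k.
  by rewrite in_cons => /orP[/eqP->|/sub //]; apply/influenceE.
move=> i j /influenceE si /influenceE sj; have [ij|ji] := leqP i j.
  by rewrite -(subnKC ij); apply: up; rewrite ?subnKC.
by rewrite -(subnKC (ltnW ji)); apply: down; rewrite // subnKC // ltnW.
Qed.

Lemma connected_convex s : dynkin_connected (influence s) -> convex_influence s.
Proof.
move=> con j k l jkl /influenceE sj /influenceE sl; apply/influenceE.
have [p [pth lst sub]] := con j l sj sl.
have jk : j <= k by lia. have kl : k <= l by lia.
move: jk kl; rewrite -{}lst; elim: p j sj {jkl} pth sub => /= [|x p IH] j sj.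
  by move=> _ _ jk kj; have -> : k = j by lia.
move=> /andP[jx px] sub jk kp; have [->//|jk'] := eqVneq k j.
apply: (IH x) => //; first exact/sub/mem_head.
  by move=> y yp; apply: sub; rewrite in_cons yp orbT.
by move: jx; rewrite /dynkin_adj; lia.
Qed.

(** Cutting at a place k where the excess vanishes: s1 is s below k and s2 is s
    from k on. *)
Lemma split_stable s k : excess s k = 0 -> exists s1 s2,
  [/\ s = (s1 * s2)%g,
      forall p : 'I_r.+1, s1 p = if p < k then s p else p,
      forall p : 'I_r.+1, s2 p = if p < k then p else s p,
      forall j, excess s1 j = if j <= k then excess s j else 0 &
      forall j, excess s2 j = if j <= k then 0 else excess s j].
Proof.
move=> sk0; have sk : s \in stable r k by rewrite -excess_eq0 sk0.
have /stableP ss := sk.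
pose A := [set p : 'I_r.+1 | p < k].
pose s1 : 'S_r.+1 := restr_perm A s; pose s2 : 'S_r.+1 := (s1^-1 * s)%g.
have s1E p : s1 p = if p < k then s p else p.
  case: ifP => pk; first by rewrite restr_permE // inE.
  by rewrite (out_perm (restr_perm_on A s)) // inE pk.
have s1VE (p : 'I_r.+1) : (s1^-1)%g p = if p < k then (s^-1)%g p else p.
  apply: (@perm_inj _ s1); rewrite permKV; case: ifP => pk; rewrite s1E ?pk //.
  by rewrite -(ss ((s^-1)%g p)) permKV pk.
have s2E p : s2 p = if p < k then p else s p.
  by rewrite permM s1VE; case: ifP => pk; rewrite ?permKV.
have s2VE (p : 'I_r.+1) : (s2^-1)%g p = if p < k then p else (s^-1)%g p.
  rewrite invMg invgK permM s1E.
  by rewrite -(ss ((s^-1)%g p)) permKV; case: ifP.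
exists s1, s2; split=> //; first by rewrite mulKVg.
- move=> j; case: ifP => jk.
    apply: (@excess_ext _ s1 s 0); rewrite ?excess0 // => p pj pr.
    by rewrite /oneline s1VE inordK //; case: ifP => //; lia.
  have s1k : excess s1 k = 0.
    rewrite -sk0; apply: (@excess_ext _ s1 s 0); rewrite ?excess0 // => p pj pr.
    by rewrite /oneline s1VE inordK //; case: ifP => //; lia.
  apply: (excess_fixed _ s1k) => [|p pk pr]; first by lia.
  by rewrite /oneline s1VE inordK //; case: ifP; [lia|rewrite inordK].
- have s2k j : j <= k -> excess s2 j = 0.
    move=> jk; apply: (@excess_fixed _ s2 0); rewrite ?excess0 // => p pj pr.
    by rewrite /oneline s2VE inordK //; case: ifP; [rewrite inordK|lia].
  move=> j; case: ifP => jk; first exact: s2k.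
  apply: (@excess_ext _ s2 s k); [lia|by rewrite s2k|move=> p pj pr].
  by rewrite /oneline s2VE inordK //; case: ifP => //; lia.
Qed.

(** Induction on the total excess: if the influence is not an interval, some k
    outside it lies between two of its letters, and both factors obtained by
    cutting at k have a smaller total excess.  The factors on the left of k only
    have letters below k and those on the right only letters above k, whence
    independence. *)
Lemma decomposition s : exists T, [/\ pairwise_independent T,
  forall b, b \in T -> [/\ b != 1%g, dynkin_connected (influence b) &
                          forall k, excess b k <= excess s k] &
  s = (\prod_(b in T) b)%g].
Proof.
have [n] := ubnP (\sum_(k < r.+1) excess s k); elim: n s => // n IH s sn.
have [->|s1] := eqVneq s 1%g.
  by exists finset.set0; split; [move=> ? ?; rewrite inE|move=> ?; rewrite inE|rewrite big_set0].
have [/convex_connected con|] := pselect (convex_influence s).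
  exists [set s]%SET; rewrite big_set1; split=> //.
    by move=> b t; rewrite !inE => /eqP-> /eqP->; rewrite eqxx.
  by move=> b; rewrite inE => /eqP->.
move=> ncvx.
have [a [k [c [akc sa sk sc]]]] : exists a k c,
    [/\ a < k < c, excess s a != 0, excess s k = 0 & excess s c != 0].
  apply: contrapT => none; apply: ncvx => a k c akc sa sc; apply/eqP => sk.
  apply: none; exists a, k, c; split=> //.
  have : (a != k) && (k != c).
    by apply/andP; split; [apply: contraNneq sa => ->|apply: contraNneq sc => <-];
      rewrite sk.
  by lia.
have [x [y [sE xE yE ex ey]]] := split_stable sk.
have lt t (m : nat) : (forall j, excess t j <= excess s j) -> excess t m = 0 ->
    excess s m != 0 -> \sum_(k < r.+1) excess t k < n.
  move=> le tm sm; have /andP[_ mr] := excess_range sm.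
  rewrite -ltnS in mr; rewrite ltnS in sn; apply: leq_trans sn.
  rewrite (bigD1 (Ordinal mr)) //= [X in _ < X](bigD1 (Ordinal mr)) //= tm add0n.
  by rewrite -add1n; apply: leq_add; [rewrite lt0n|apply: leq_sum].
have xle j : excess x j <= excess s j by rewrite ex; case: ifP.
have yle j : excess y j <= excess s j by rewrite ey; case: ifP.
have [X [indX propX prodX]] : exists T, [/\ pairwise_independent T,
  forall b, b \in T -> [/\ b != 1%g, dynkin_connected (influence b) &
                          forall k, excess b k <= excess x k] &
  x = (\prod_(b in T) b)%g].
  by apply: IH; apply: (lt _ c xle _ sc); rewrite ex; case: ifP => //; lia.
have [Y [indY propY prodY]] : exists T, [/\ pairwise_independent T,
  forall b, b \in T -> [/\ b != 1%g, dynkin_connected (influence b) &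
                          forall k, excess b k <= excess y k] &
  y = (\prod_(b in T) b)%g].
  by apply: IH; apply: (lt _ a yle _ sa); rewrite ey; case: ifP => //; lia.
have lowX b j : b \in X -> excess b j != 0 -> j < k.
  move=> /propX[_ _ /(_ j)]; rewrite ex; case: ifP => jk; last by lia.
  have [->|] := eqVneq j k; first by rewrite sk; lia.
  by move: jk; lia.
have highY b j : b \in Y -> excess b j != 0 -> k < j.
  by move=> /propY[_ _ /(_ j)]; rewrite ey; case: ifP => jk; lia.
have indXY : pairwise_independent (X :|: Y).
  move=> b t; rewrite !inE => /orP[bX|bY] /orP[tX|tY] bt.
  - exact: indX.
  - apply/independentP => j m /(lowX _ _ bX) ? /(highY _ _ tY) ?; lia.
  - apply/independentP => j m /(highY _ _ bY) ? /(lowX _ _ tX) ?; lia.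
  - exact: indY.
(* The product over X :|: Y comes in the enumeration order of the group, not
   as the one over X followed by the one over Y, so both sides are compared
   pointwise. *)
exists (X :|: Y)%SET; split=> //.
  move=> b; rewrite inE => /orP[/propX|/propY] [b1 con le]; split=> // j.
    exact: leq_trans (le j) (xle j).
  exact: leq_trans (le j) (yle j).
apply: eq_prod_independent => // p.
have [[t tX tp]|noX] := pselect (exists2 t, t \in X & t p != p).
  left; exists t; rewrite ?inE ?tX //; split=> //.
  have xp : x p = t p by rewrite prodX (prod_moved indX tX tp).
  by move: tp; rewrite -xp xE; case: ifP => //; rewrite eqxx.
have fxX t : t \in X -> t p = p.
  by move=> tX; apply/eqP; apply: contraT => tp; case: noX; exists t.
have [[t tY tp]|noY] := pselect (exists2 t, t \in Y & t p != p).
  left; exists t; rewrite ?inE ?tY ?orbT //; split=> //.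
  have yp : y p = t p by rewrite prodY (prod_moved indY tY tp).
  by move: tp; rewrite -yp yE; case: ifP => //; rewrite eqxx.
have fxY t : t \in Y -> t p = p.
  by move=> tY; apply/eqP; apply: contraT => tp; case: noY; exists t.
right; split; first by rewrite sE permM prodX prod_fix // prodY prod_fix.
by move=> t; rewrite inE => /orP[/fxX|/fxY].
Qed.

Section BAS.
Variables (R : realType) (lambda mu : 'rV[R]_r.+1).

(** An element of S is a product of independent elements of S'; being connected,
    it is one of them. *)
Lemma BAS_sub (S S' : set 'S_r.+1) :
  is_BAS lambda mu S -> is_BAS lambda mu S' -> (S `<=` S')%classic.
Proof.
move=> [SA S1 Scon _] [_ S'1 _ dec] b Sb.
have [T [TS' ind bE]] := dec b (SA b Sb).
suff bT : b \in T by exact: TS' bT.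
rewrite bE; apply: connected_prod => //.
- by apply/negP => /TS'.
- by rewrite -bE; apply/eqP => b1; rewrite b1 in Sb.
- by rewrite -bE; apply: Scon.
Qed.

Lemma BAS_downward_closed :
  (forall s t, alternation lambda mu s ->
     (forall k, excess t k <= excess s k) -> alternation lambda mu t) ->
  is_BAS lambda mu [set b | [/\ alternation lambda mu b, b != 1%g &
                              dynkin_connected (influence b)]]%classic.
Proof.
move=> down; split=> [b []//|[_]|b []//|s As]; first by rewrite eqxx.
have [T [ind prop sE]] := decomposition s; exists T; split=> // b /prop[b1 con le].
by split=> //; apply: down As le.
Qed.

End BAS.
End Decomposition.

(** * Positivity of the partition function via partial sums *)

Section Kostant.
Variables (R : realType) (r : nat).
Implicit Types (v w : 'rV[R]_r.+1) (s : 'S_r.+1).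
Local Open Scope ring_scope.

Definition psum v (k : nat) : R := \sum_(j < r.+1 | (j < k)%N) v 0 j.

Lemma psum0 v : psum v 0 = 0.
Proof. by rewrite /psum big_pred0. Qed.

Lemma psum_sum (I : Type) (L : seq I) (P : pred I) (F : I -> 'rV[R]_r.+1) k :
  psum (\sum_(i <- L | P i) F i) k = \sum_(i <- L | P i) psum (F i) k.
Proof.
rewrite /psum exchange_big /=; apply: eq_bigr => j _.
by rewrite summxE.
Qed.

Lemma psumD v w k : psum (v + w) k = psum v k + psum w k.
Proof. by rewrite /psum -big_split; apply: eq_bigr => j _; rewrite mxE. Qed.

Lemma psumN v k : psum (- v) k = - psum v k.
Proof. by rewrite /psum -sumrN; apply: eq_bigr => j _; rewrite mxE. Qed.

Lemma psumMn v n k : psum (v *+ n) k = psum v k *+ n.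
Proof. by rewrite /psum -sumrMnl; apply: eq_bigr => j _; rewrite mulmxnE. Qed.

Lemma evecE k (j : 'I_r.+1) : (k <= r)%N ->
  evec R r k.+1 0 j = (j == k :> nat)%:R.
Proof. by move=> kr; rewrite /evec mxE eqxx /= -val_eqE /= inordK. Qed.

Lemma psum_evec m k : (m <= r)%N -> psum (evec R r m.+1) k = (m < k)%N%:R.
Proof.
move=> mr; rewrite /psum; case: ltnP => mk.
  rewrite (bigD1 (inord m)) /= ?inordK // evecE // inordK // eqxx.
  rewrite big1 ?addr0 // => j /andP[_ jm]; rewrite evecE //.
  by move: jm; rewrite -val_eqE /= inordK // => /negPf ->.
rewrite big1 // => j jk; rewrite evecE //.
by case: eqP => // jm; move: jk; rewrite jm ltnNge mk.
Qed.

Lemma psum_simple m k : (0 < m <= r)%N ->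
  psum (simple_root R r m) k = (k == m)%:R.
Proof.
case: m => // m mr; rewrite /simple_root psumD psumN !psum_evec; try lia.
by case: ltngtP => ?; case: ltngtP => ?; rewrite ?subrr ?subr0 //; lia.
Qed.

Lemma psum_aroot a b k : (0 < a)%N -> (b <= r)%N ->
  psum (aroot R r a b) k = (a <= k <= b)%N%:R.
Proof.
move=> a0 br; rewrite /aroot psum_sum big_seq.
under eq_bigr => m hm.
  rewrite psum_simple; last by move: hm; rewrite mem_index_iota; lia.
  over.
rewrite -big_seq; case: (boolP (a <= k <= b)%N) => ab.
  rewrite (bigD1_seq k) ?iota_uniq //=; last by rewrite mem_index_iota; lia.
  by rewrite eqxx big1 ?addr0 // => m; rewrite eq_sym => /negPf ->.
rewrite big_seq big1 // => m; rewrite mem_index_iota.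
by case: eqP => [<-|]//; lia.
Qed.

Lemma psum_diff v (j : 'I_r.+1) : v 0 j = psum v j.+1 - psum v j.
Proof.
rewrite /psum [X in _ = X - _](bigD1 j) //=.
rewrite (eq_bigl (fun i : 'I_r.+1 => (i < j)%N)) ?addrK // => i.
by rewrite ltnS -val_eqE /= [RHS]ltn_neqAle andbC.
Qed.

Lemma psum_inj v w :
  (forall k, (0 < k <= r.+1)%N -> psum v k = psum w k) -> v = w.
Proof.
move=> e; apply/matrixP => i j; rewrite !ord1 !psum_diff e ?ltn_ord //.
case: (posnP j) => [->|j0]; last by rewrite e // j0 ltnW.
by rewrite !psum0.
Qed.

Lemma psum_kostant (c : {ffun posroot r -> nat}) k :
  psum (\sum_(p : posroot r) root_of R p *+ c p) k =
  (\sum_(p : posroot r | ((val p).1 <= k <= (val p).2)%N) c p)%:R.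
Proof.
rewrite psum_sum natr_sum [RHS]big_mkcond /=; apply: eq_bigr => p _.
rewrite psumMn psum_aroot; last by rewrite -ltnS.
  by case: ifP => _; rewrite ?mul0rn // -natrE.
by case/andP: (valP p).
Qed.

(** The multiplicity of alpha_{a,b} is at most the partial sum at a, to which all
    roots containing alpha_a contribute. *)
Lemma kostant_finite v : finite_set [set c : {ffun posroot r -> nat} |
  v = (\sum_(p : posroot r) root_of R p *+ c p)%R]%classic.
Proof.
pose N := \sum_(k < r.+2) Num.truncn (psum v k).
pose F (d : {ffun posroot r -> 'I_N.+1}) := [ffun p => d p : nat].
apply: (@sub_finite_set _ _ (F @` setT)%classic); last first.
  exact/finite_image/finite_finset.
move=> c /= vE; exists [ffun p => inord (c p)] => //.
apply/ffunP => p; rewrite !ffunE inordK // ltnS.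
have /andP[p1 p12] := valP p; have p1r := ltn_ord (val p).1.
have h : (c p <= Num.truncn (psum v (val p).1))%N.
  rewrite vE psum_kostant natrK (bigD1 p) /=; last by rewrite leqnn.
  exact: leq_addr.
apply: (leq_trans h); rewrite /N.
by rewrite (bigD1 (widen_ord (leqnSn _) (val p).1)) //= leq_addr.
Qed.

(** The partial sum at k is the coefficient of alpha_k.  Conversely, nonnegative
    coefficients give a decomposition with simple roots only. *)
Lemma kostant_gt0 v (m : nat -> int) : psum v r.+1 = 0 ->
  (forall k, (0 < k <= r)%N -> psum v k = (m k)%:~R) ->
  (0 < kostant v)%N <-> (forall k, (0 < k <= r)%N -> 0 <= m k).
Proof.
move=> v0 vm; rewrite /kostant cardfs_gt0; split=> [/fset0Pn[c]|m0].
  rewrite in_fset_set; last exact: kostant_finite.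
  rewrite inE /= => vE k kr; rewrite -(ler0z R) -vm // vE psum_kostant.
  exact: ler0n.
pose c : {ffun posroot r -> nat} :=
  [ffun p : posroot r => if (val p).1 == (val p).2 then `|m (val p).1|%N else 0%N].
apply/fset0Pn; exists c; rewrite in_fset_set; last exact: kostant_finite.
rewrite inE /=; apply: psum_inj => k kr; rewrite psum_kostant.
have [kr'|kr'] := leqP k r; last first.
  have -> : k = r.+1 by lia.
  rewrite v0 big_pred0 // => p; apply/negbTE.
  by have := ltn_ord (val p).2; lia.
rewrite vm; last by lia.
have Hk : (1 <= (@inord r k) <= (@inord r k))%N by rewrite inordK; lia.
rewrite (bigD1 (exist _ (inord k, inord k) Hk : posroot r)) /=; last first.
  by rewrite inordK // leqnn.
rewrite ffunE /= eqxx inordK // big1 ?addn0 => [|p /andP[kp np]].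
  by rewrite -[LHS]/((m k)%:~R) natr_absz ger0_norm //; apply: m0; lia.
rewrite ffunE; case: eqP => // e; case/eqP: np; apply: val_inj.
have e2 : val (val p).1 = k by have := congr1 val e; move=> /= ?; lia.
by rewrite /= [val p]surjective_pairing -e; congr (_, _);
  apply: val_inj => /=; rewrite inordK.
Qed.

End Kostant.

(** * The alternation set in terms of the excess *)

Section Alternation.
Variables (R : realType) (r : nat).
Implicit Types (s : 'S_r.+1).
Local Open Scope ring_scope.

Lemma sum_nat_interval n k : (\sum_(a < n) (0 < a <= k) = minn k n.-1)%N.
Proof.
elim: n => [|n IH]; first by rewrite big_ord0; lia.
by rewrite big_ord_recr /= IH; case: n {IH} => [|n] /=; lia.
Qed.

Lemma sum_nat_above n k : (\sum_(b < n) (k <= b) = n - k)%N.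
Proof.
elim: n => [|n IH]; first by rewrite big_ord0.
by rewrite big_ord_recr /= IH; lia.
Qed.

(** The positive roots containing alpha_k are given by a left end among the k
    first letters and a right end among the r + 1 - k last ones. *)
Lemma sum_posroot k :
  (\sum_(p : posroot r) ((val p).1 <= k <= (val p).2) = k * (r.+1 - k))%N.
Proof.
rewrite -(big_sub (fun q : 'I_r.+1 * 'I_r.+1 => (1 <= q.1 <= q.2)%N)
  (fun q => ((q.1 <= k <= q.2)%N : nat))) /=.
rewrite big_mkcond /=.
rewrite (eq_bigr (fun q : 'I_r.+1 * 'I_r.+1 =>
  (0 < q.1 <= k)%N * (k <= q.2)%N)%N) => [|q _]; last first.
  by rewrite unfold_in; case: ifP; lia.
rewrite -(pair_big xpredT xpredT (fun a b : 'I_r.+1 =>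
  (0 < a <= k)%N * (k <= b)%N)%N) /=.
rewrite -big_distrlr /= sum_nat_interval sum_nat_above.
have [//|rk] := leqP k r.
have -> : (r.+1 - k = 0)%N by lia.
by rewrite !muln0.
Qed.

Lemma psum_rho k : psum (rho R r) k = 2^-1 * (k * (r.+1 - k))%:R.
Proof.
transitivity (2^-1 * psum (\sum_(p : posroot r) root_of R p) k).
  by rewrite /rho /psum big_distrr; apply: eq_bigr => j _; rewrite mxE.
rewrite psum_sum -sum_posroot natr_sum; congr (_ * _).
apply: eq_bigr => p _; rewrite psum_aroot //; last by rewrite -ltnS.
by case/andP: (valP p).
Qed.

(** Up to the constant r / 2, the weight rho is minus the position: this is what
    turns partial sums of sigma rho - rho into minus the excess. *)
Lemma rhoE (j : 'I_r.+1) : rho R r 0 j = 2^-1 * r%:R - (j : nat)%:R.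
Proof.
rewrite psum_diff !psum_rho; have := ltn_ord j; move: (nat_of_ord j) => n nr.
rewrite subSS !natrM !natrB; try lia.
by rewrite -!natr1; field.
Qed.

Lemma highest_rootE (j : 'I_r.+1) :
  highest_root R r 0 j = (j == 0 :> nat)%:R - (j == r :> nat)%:R.
Proof.
rewrite psum_diff !psum_aroot //; have := ltn_ord j.
move: (nat_of_ord j) => n; rewrite ltnS => nr.
have /(congr1 (fun m => m%:R : R)) :
  ((0 < n.+1 <= r) + (n == r) = (n == 0) + (0 < n <= r))%N by lia.
rewrite !natrD; lra.
Qed.

Lemma initial_sum_eq s k :
  (\sum_(p < r.+1 | p < k) (s^-1)%g p =
   \sum_(p < r.+1 | p < k) p + excess s k)%N.
Proof. by rewrite subnKC //; have := initial_sum_excess s k; lia. Qed.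

Lemma sum_preimage s (q : 'I_r.+1) k :
  \sum_(p < r.+1 | (p < k)%N) ((s^-1)%g p == q :> nat)%:R = (s q < k)%N%:R :> R.
Proof.
have pE (p : 'I_r.+1) : ((s^-1)%g p == q :> nat) = (p == s q).
  by rewrite (inj_eq val_inj); apply/eqP/eqP => [<-|->]; rewrite ?permKV ?permK.
case: ltnP => qk.
  rewrite (bigD1 (s q)) //= pE eqxx big1 ?addr0 // => p /andP[_].
  by rewrite pE => /negPf ->.
rewrite big1 // => p pk; rewrite pE; case: eqP => // e.
by move: pk; rewrite e ltnNge qk.
Qed.

Lemma psum_shifted_weight s i k : (0 < i)%N ->
  psum (wact s (highest_root R r + rho R r) - - aroot R r i r - rho R r) k =
  ((s ord0 < k)%N%:R - (s ord_max < k)%N%:R - (excess s k)%:R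
    + (i <= k <= r)%N%:R).
Proof.
move=> i0; rewrite !psumD !psumN opprK psum_aroot // -!sum_preimage.
have -> : psum (wact s (highest_root R r + rho R r)) k =
  \sum_(p < r.+1 | (p < k)%N) ((s^-1)%g p == @ord0 r :> nat)%:R -
  \sum_(p < r.+1 | (p < k)%N) ((s^-1)%g p == @ord_max r :> nat)%:R +
  \sum_(p < r.+1 | (p < k)%N) (2^-1 * r%:R - ((s^-1)%g p : nat)%:R).
  rewrite -sumrB -big_split; apply: eq_bigr => p _.
  by rewrite [LHS]mxE [LHS]mxE highest_rootE rhoE.
rewrite /psum.
rewrite (eq_bigr (fun p : 'I_r.+1 => 2^-1 * r%:R - (p : nat)%:R)
   (fun p _ => rhoE p)).
have e := congr1 (fun n => n%:R : R) (initial_sum_eq s k).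
rewrite /= natrD !natr_sum in e; rewrite !sumrB e; ring.
Qed.

Lemma oneline_s s (q : 'I_r.+1) : oneline s (s q) = q.
Proof. by rewrite /oneline inord_val permK. Qed.

Definition allowable i s : Prop :=
  [/\ excess s 1 = 0%N,
      forall k, (excess s k <= 1 + (i <= k))%N &
      excess s r != 0%N -> excess s r = 1%N /\ excess s r.-1 = 0%N].

(** Nonnegativity of the partial sum at 1 forces 0 to be fixed, since i > 1, and
    the excess is then at most 1 + [i <= k].  The condition at r comes from the
    last basis vector: it lowers the partial sums from the position t of the value
    r on.  If t < r then the excess jumps by r - t at t, which the lowered bound
    allows only for t = r - 1 and with excess 0 before it. *)
Lemma alternationE s i : (1 < i <= r)%N ->
  alternation (highest_root R r) (- aroot R r i r) s <->
  allowable i s.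
Proof.
move=> ir; rewrite /alternation /allowable /=.
rewrite (@kostant_gt0 R r _ (fun k => (s ord0 < k)%N%:Z - (s ord_max < k)%N%:Z
  - (excess s k)%:Z + (i <= k)%N%:Z)).
- have hb := oneline_s s ord0; have ht := oneline_s s ord_max.
  have bL : (s ord0 <= r)%N by rewrite -ltnS.
  have tL : (s ord_max <= r)%N by rewrite -ltnS.
  rewrite /= in hb ht.
  (* b and t are the positions of the first and of the last basis vector. *)
  move: (nat_of_ord (s ord0)) (nat_of_ord (s ord_max)) hb ht bL tL => b t.
  move=> hb ht bL tL.
  have E0 := excessS s (leq0n r); rewrite excess0 !addn0 add0n in E0.
  have Er := excessS s (leqnn r); rewrite (excess_out s (ltnSn r)) in Er.
  have Et := excessS s tL; rewrite ht in Et.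
  split=> [pos|[e1 le er]].
    have b0 : b = 0%N.
      have p1 := pos 1%N; have z : (oneline s 0 = 0 -> b = 0)%N.
        by move=> z; apply: (oneline_inj (s := s)); rewrite // hb z.
      lia.
    have e1 : excess s 1 = 0%N by rewrite E0 -[in oneline _ _]b0.
    split=> [//|k|enz].
      have [k0|k0] := posnP k; first by rewrite k0 excess0.
      have [rk|kr] := ltnP r k; first by rewrite excess_out.
      by have := pos k; lia.
    have tr : t <> r by move=> e; move: ht; rewrite e; lia.
    have pr := pos r; have pt := pos t.+1.
    have [t1|t1] := eqVneq t r.-1.
      rewrite t1 prednK in Et; last by lia.
      by split; lia.
    lia.
  move=> k kr.
  have b0 : b = 0%N.
    by apply: (oneline_inj (s := s)); rewrite // hb -E0 e1.
  have := le k; case: (ltnP t k) => tk; last by lia.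
  have onr : oneline s r <> r.
    by move=> e; have := @oneline_inj r s r t (leqnn r) tL; rewrite ht e; lia.
  have r1r : (r.-1 <= r)%N by lia.
  have Er1 := excessS s r1r; rewrite prednK in Er1; last by lia.
  have [|er1 er0] := er; first by lia.
  have tE : t = r.-1 by apply: (oneline_inj (s := s)); rewrite // ht; lia.
  have -> : k = r by lia.
  by lia.
- rewrite psum_shifted_weight; last by lia.
  rewrite (excess_out s (ltnSn r)) !ltn_ord.
  by case: (boolP (i <= r.+1 <= r)%N); [lia|rewrite subrr subr0 addr0].
- move=> k kr; rewrite psum_shifted_weight; last by lia.
  have -> : (i <= k <= r)%N = (i <= k)%N by lia.
  by rewrite !(rmorphD, rmorphN, rmorphB).
Qed.

End Alternation.

(** * Excess of the basic words *)

Section Profiles.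
Variable r : nat.
Implicit Types (s t : 'S_r.+1).
Local Open Scope nat_scope.

Lemma excess_inj s t : (forall k, excess s k = excess t k) -> s = t.
Proof.
move=> e; apply: oneline_ext => p pr.
by have := excessS s pr; have := excessS t pr; rewrite !e; lia.
Qed.

Lemma oneline_word (w : seq nat) p : letters r w -> p <= r ->
  oneline (word r w) p = foldl (fun q k => swap k q) p w.
Proof.
elim: w p => [|k w IH] p; first by move=> _ pr; rewrite oneline1.
move=> /= /andP[kr lw] pr; rewrite -/(word r (k :: w)) oneline_word_cons // IH //.
by rewrite /swap; do ![case: eqP => ?]; lia.
Qed.

Lemma excess_notin (w : seq nat) k : letters r w -> k \notin w ->
  excess (word r w) k = 0.
Proof.
elim: w => [|j w IH]; first by rewrite excess1.
move=> /= /andP[jr lw]; rewrite in_cons negb_or => /andP[kj kw].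
by apply/eqP; apply: contraT; rewrite -/(word r (j :: w)) excess_cons_neq // IH.
Qed.

Lemma swapL k : swap k.+1 k = k.+1.
Proof. by rewrite /swap /= eqxx. Qed.

Lemma swapR k : swap k.+1 k.+1 = k.
Proof. by rewrite /swap /= eqxx; case: eqP => //; lia. Qed.

Lemma swapD k p : p != k -> p != k.+1 -> swap k.+1 p = p.
Proof. by rewrite /swap /= => /negPf -> /negPf ->. Qed.

Ltac eval_swap := repeat (rewrite swapL || rewrite swapR ||
  match goal with |- context [swap (S ?k) ?p] =>
    rewrite (@swapD k p); [|by lia|by lia] end).

Lemma excess_word1 k j : 0 < k <= r -> excess (word r [:: k]) j = (j == k).
Proof.
case: k => // k kr; set w := [:: _].
have lw : letters r w by rewrite /letters /=; lia.
have [jw|jw] := boolP (j \in w); last first.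
  by rewrite excess_notin //; move: jw; rewrite !inE; lia.
have k0 : k <= r by lia.
have e0 : excess (word r w) k = 0 by rewrite excess_notin // !inE; lia.
have := excessS (word r w) k0.
rewrite !oneline_word // e0 /=; eval_swap.
by move: jw; rewrite !inE => /eqP ->; lia.
Qed.

Lemma excess_word_desc k j : 0 < k < r ->
  excess (word r [:: k.+1; k]) j = (j == k) + 2 * (j == k.+1).
Proof.
case: k => // k kr; set w := [:: _; _].
have lw : letters r w by rewrite /letters /=; lia.
have [jw|jw] := boolP (j \in w); last first.
  by rewrite excess_notin //; move: jw; rewrite !inE; lia.
have k0 : k <= r by lia. have k1 : k.+1 <= r by lia.
have e0 : excess (word r w) k = 0 by rewrite excess_notin // !inE; lia.
have := excessS (word r w) k0; have := excessS (word r w) k1.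
rewrite !oneline_word // e0 /=; eval_swap.
by move: jw; rewrite !inE => /orP[]/eqP ->; lia.
Qed.

Lemma excess_word_asc k j : 0 < k < r ->
  excess (word r [:: k; k.+1]) j = 2 * (j == k) + (j == k.+1).
Proof.
case: k => // k kr; set w := [:: _; _].
have lw : letters r w by rewrite /letters /=; lia.
have [jw|jw] := boolP (j \in w); last first.
  by rewrite excess_notin //; move: jw; rewrite !inE; lia.
have k0 : k <= r by lia. have k1 : k.+1 <= r by lia.
have e0 : excess (word r w) k = 0 by rewrite excess_notin // !inE; lia.
have := excessS (word r w) k0; have := excessS (word r w) k1.
rewrite !oneline_word // e0 /=; eval_swap.
by move: jw; rewrite !inE => /orP[]/eqP ->; lia.
Qed.

Lemma excess_word_braid k j : 0 < k < r ->
  excess (word r [:: k; k.+1; k]) j = 2 * (j == k) + 2 * (j == k.+1).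
Proof.
case: k => // k kr; set w := [:: _; _; _].
have lw : letters r w by rewrite /letters /=; lia.
have [jw|jw] := boolP (j \in w); last first.
  by rewrite excess_notin //; move: jw; rewrite !inE; lia.
have k0 : k <= r by lia. have k1 : k.+1 <= r by lia.
have e0 : excess (word r w) k = 0 by rewrite excess_notin // !inE; lia.
have := excessS (word r w) k0; have := excessS (word r w) k1.
rewrite !oneline_word // e0 /=; eval_swap.
by move: jw; rewrite !inE => /or3P[]/eqP ->; lia.
Qed.

Lemma excess_word_zigzag k j : 0 < k -> k.+1 < r ->
  excess (word r [:: k.+2; k; k.+1]) j =
  2 * (j == k) + (j == k.+1) + 2 * (j == k.+2).
Proof.
case: k => // k k0' kr; set w := [:: _; _; _].
have lw : letters r w by rewrite /letters /=; lia.
have [jw|jw] := boolP (j \in w); last first.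
  by rewrite excess_notin //; move: jw; rewrite !inE; lia.
have k0 : k <= r by lia. have k1 : k.+1 <= r by lia. have k2 : k.+2 <= r by lia.
have e0 : excess (word r w) k = 0 by rewrite excess_notin // !inE; lia.
have := excessS (word r w) k0; have := excessS (word r w) k1.
have := excessS (word r w) k2.
rewrite !oneline_word // e0 /=; eval_swap.
by move: jw; rewrite !inE => /or3P[]/eqP ->; lia.
Qed.

(** * Classification of the connected allowable permutations *)

Section Classification.
Variables (i : nat) (ir : 1 < i <= r).

Definition basic_words : set 'S_r.+1 :=
  ([set word r [:: k] | k in [set k | (1 < k <= r)%N]]
      `|` [set word r [:: k.+1; k] | k in
            [set k | (maxn (i - 1) 2 <= k <= r - 2)%N]]
      `|` [set word r [:: k; k.+1] | k in [set k | (i <= k <= r - 2)%N]]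
      `|` [set word r [:: k; k.+1; k] | k in [set k | (i <= k <= r - 2)%N]]
      `|` [set word r [:: k.+2; k; k.+1] | k in
            [set k | (i <= k <= r - 3)%N]])%classic.

Lemma basic_words_sub b : basic_words b ->
  [/\ allowable i b, b != 1%g & convex_influence b].
Proof.
have ne1 k : excess b k != 0 -> b != 1%g.
  by apply: contraNneq => ->; rewrite excess1.
rewrite /allowable /convex_influence.
move=> [[[[]|]|]|] [k /= kr bE].
- have e j : excess b j = (j == k) by rewrite -bE excess_word1 //; lia.
  by split; [split=> [|j|]; rewrite !e; lia|apply: (ne1 k); rewrite e; lia|
    move=> j l m; rewrite !e; lia].
- have e j : excess b j = (j == k) + 2 * (j == k.+1).
    by rewrite -bE excess_word_desc //; lia.
  by split; [split=> [|j|]; rewrite !e; lia|apply: (ne1 k); rewrite e; lia|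
    move=> j l m; rewrite !e; lia].
- have e j : excess b j = 2 * (j == k) + (j == k.+1).
    by rewrite -bE excess_word_asc //; lia.
  by split; [split=> [|j|]; rewrite !e; lia|apply: (ne1 k); rewrite e; lia|
    move=> j l m; rewrite !e; lia].
- have e j : excess b j = 2 * (j == k) + 2 * (j == k.+1).
    by rewrite -bE excess_word_braid //; lia.
  by split; [split=> [|j|]; rewrite !e; lia|apply: (ne1 k); rewrite e; lia|
    move=> j l m; rewrite !e; lia].
- have e j : excess b j = 2 * (j == k) + (j == k.+1) + 2 * (j == k.+2).
    by rewrite -bE excess_word_zigzag //; lia.
  by split; [split=> [|j|]; rewrite !e; lia|apply: (ne1 k); rewrite e; lia|
    move=> j l m; rewrite !e; lia].
Qed.

(** Let q + 1 be the least letter of b, so that all points below q are fixed.  Each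
    of the next values of the one-line notation is at least q and differs from the
    previous ones, and the excess stays at most 2; this leaves one or two choices
    at each step until the excess returns to 0, from where on it vanishes since
    the influence is an interval. *)
Lemma allowable_convex_basic b :
  allowable i b -> b != 1%g -> convex_influence b -> basic_words b.
Proof.
move=> [e1 le er] b1 cvx.
have [x ex minx] := ex_minnP (ex_excess b1).
have /andP[x0 xr] := excess_range ex.
have low j : j < x -> excess b j = 0.
  by move=> jx; apply/eqP; apply: contraTT jx => /minx; rewrite leqNgt.
have x1 : x != 1 by apply: contraNneq ex => ->; rewrite e1.
have high m j : excess b m = 0 -> x < m <= j -> excess b j = 0.
  move=> em mj; apply/eqP; apply: contraT => ej; move: em => /eqP.
  by apply: contraTT => _; apply: (cvx x m j) => //; lia.
have [q qE] : exists q, x = q.+1 by exists x.-1; lia.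
have {}e0 : excess b q = 0 by apply: low; lia.
have ge p : q <= p <= r -> q <= oneline b p by apply: oneline_ge.
have inj p p' : p <> p' -> p <= r -> p' <= r -> oneline b p <> oneline b p'.
  by move=> pp' pr p'r /(oneline_inj pr p'r).
have step p : p <= r -> excess b p.+1 + p = excess b p + oneline b p.
  exact: excessS.
have out j : r < j -> excess b j = 0 by apply: excess_out.
(* The condition at r forbids an excess 2 at r, and a nonzero excess at both
   r - 1 and r: this keeps the blocks other than s_r away from r. *)
have nr k : k <= r -> excess b k = 2 -> k < r.
  move=> kr ek; rewrite ltn_neqAle kr andbT; apply/eqP => kE.
  by rewrite kE in ek; lia.
have nr' k : k.+1 <= r -> excess b k != 0 -> excess b k.+1 != 0 -> k.+1 < r.
  move=> kr ek ek1; rewrite ltn_neqAle kr andbT; apply/eqP => kE.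
  have k1 : k = r.-1 by lia.
  by rewrite kE in ek1; rewrite k1 in ek; lia.
rewrite qE in ex xr x0 x1 low high; clear x minx qE.
have w0 := step q (ltnW xr); rewrite e0 add0n in w0.
have l1 := le q.+1; have l2 := le q.+2; have l3 := le q.+3.
have i01 := inj q q.+1 (@n_Sn q) (ltnW xr) xr.
have w1 := step _ xr; have g1 := ge q.+1; rewrite leqnSn xr in g1.
have {}g1 := g1 isT.
have [ex1|ex2] : excess b q.+1 = 1 \/ excess b q.+1 = 2.
  by move: l1 ex; clear; case: (i <= _); lia.
- have [ey|ey] : excess b q.+2 = 0 \/ excess b q.+2 = 2.
    by move: l2 w0 w1 g1 i01 ex1; clear; case: (i <= _); lia.
    left; left; left; left; exists q.+1 => /=; first by clear -xr x1; lia.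
    apply: excess_inj => j; rewrite excess_word1 //.
    have [jq|jq] := ltnP j q.+1; first by rewrite low //; clear -jq; lia.
    have [->|jq1] := eqVneq j q.+1; first by rewrite ex1.
    by rewrite (high q.+2) //; clear -jq jq1; lia.
  have yr : q.+2 <= r by rewrite leqNgt; apply/negP => /out; rewrite ey.
  have yr' := nr _ yr ey.
  have g2 : q <= oneline b q.+2 by apply: ge; clear -yr; lia.
  have i02 : oneline b q <> oneline b q.+2 by apply: inj; clear -yr; lia.
  have i12 : oneline b q.+1 <> oneline b q.+2 by apply: inj; clear -yr; lia.
  have w2 := step _ yr.
  have ez : excess b q.+3 = 0.
    by move: l3 w0 w1 w2 g2 i02 i12 ex1 ey; clear; case: (i <= _); lia.
  left; left; left; right; exists q.+1 => /=.
    by move: l2; rewrite ey; clear -yr' x1; lia.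
  apply: excess_inj => j; rewrite excess_word_desc; last by clear -yr'; lia.
  have [jq|jq] := ltnP j q.+1; first by rewrite low //; clear -jq; lia.
  have [->|jq1] := eqVneq j q.+1; first by rewrite ex1; clear; lia.
  have [->|jq2] := eqVneq j q.+2; first by rewrite ey; clear; lia.
  by rewrite (high q.+3) //; clear -jq jq1 jq2; lia.
have ix : i <= q.+1 by move: l1; rewrite ex2; clear; lia.
have xr' := nr _ xr ex2.
have i02 : oneline b q <> oneline b q.+2 by apply: inj; clear -xr'; lia.
have i12 : oneline b q.+1 <> oneline b q.+2 by apply: inj; clear -xr'; lia.
have g2 : q <= oneline b q.+2 by apply: ge; clear -xr'; lia.
have w2 := step _ xr'.
have [ey|ey] : excess b q.+2 = 1 \/ excess b q.+2 = 2.
  by move: l2 w0 w1 g1 i01 ex2; clear; case: (i <= _); lia.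
- have yr' : q.+2 < r by apply: nr' => //; rewrite ?ex2 ?ey.
  have [ez|ez] : excess b q.+3 = 0 \/ excess b q.+3 = 2.
    by move: l3 w0 w1 w2 g2 i02 i12 ex2 ey; clear; case: (i <= _); lia.
    left; left; right; exists q.+1 => /=; first by clear -yr' ix; lia.
    apply: excess_inj => j; rewrite excess_word_asc; last by clear -yr'; lia.
    have [jq|jq] := ltnP j q.+1; first by rewrite low //; clear -jq; lia.
    have [->|jq1] := eqVneq j q.+1; first by rewrite ex2; clear; lia.
    have [->|jq2] := eqVneq j q.+2; first by rewrite ey; clear; lia.
    by rewrite (high q.+3) //; clear -jq jq1 jq2; lia.
  have zr' := nr _ yr' ez.
  have i03 : oneline b q <> oneline b q.+3 by apply: inj; clear -yr'; lia.
  have i13 : oneline b q.+1 <> oneline b q.+3 by apply: inj; clear -yr'; lia.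
  have i23 : oneline b q.+2 <> oneline b q.+3 by apply: inj; clear -yr'; lia.
  have g3 : q <= oneline b q.+3 by apply: ge; clear -yr'; lia.
  have w3 := step _ yr'; have l4 := le q.+4.
  have ew : excess b q.+4 = 0.
    move: l4 w0 w1 w2 w3 g3 i03 i13 i23 ex2 ey ez.
    by clear; case: (i <= _); lia.
  right; exists q.+1 => /=; first by clear -zr' ix; lia.
  apply: excess_inj => j; rewrite excess_word_zigzag //.
  have [jq|jq] := ltnP j q.+1; first by rewrite low //; clear -jq; lia.
  have [->|jq1] := eqVneq j q.+1; first by rewrite ex2; clear; lia.
  have [->|jq2] := eqVneq j q.+2; first by rewrite ey; clear; lia.
  have [->|jq3] := eqVneq j q.+3; first by rewrite ez; clear; lia.
  by rewrite (high q.+4) //; clear -jq jq1 jq2 jq3; lia.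
have yr' := nr _ xr' ey.
have ez : excess b q.+3 = 0.
  by move: l3 w0 w1 w2 g2 i02 i12 ex2 ey; clear; case: (i <= _); lia.
left; right; exists q.+1 => /=; first by clear -yr' ix; lia.
apply: excess_inj => j; rewrite excess_word_braid //.
have [jq|jq] := ltnP j q.+1; first by rewrite low //; clear -jq; lia.
have [->|jq1] := eqVneq j q.+1; first by rewrite ex2; clear; lia.
have [->|jq2] := eqVneq j q.+2; first by rewrite ey; clear; lia.
by rewrite (high q.+3) //; clear -jq jq1 jq2; lia.
Qed.

End Classification.
End Profiles.

Local Open Scope ring_scope.
Local Open Scope classical_set_scope.

Theorem corollary4p10 (R : realType) (r i : nat) (hi : (1 < i <= r)%N)
    (S : set 'S_r.+1) :
  is_BAS (highest_root R r) (- aroot R r i r) S <->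
  S = [set word r [:: k] | k in [set k | (1 < k <= r)%N]]
      `|` [set word r [:: k.+1; k] | k in
            [set k | (maxn (i - 1) 2 <= k <= r - 2)%N]]
      `|` [set word r [:: k; k.+1] | k in [set k | (i <= k <= r - 2)%N]]
      `|` [set word r [:: k; k.+1; k] | k in [set k | (i <= k <= r - 2)%N]]
      `|` [set word r [:: k.+2; k; k.+1] | k in
            [set k | (i <= k <= r - 3)%N]].
Proof.
rewrite -/(@basic_words r i).
have altE s : alternation (highest_root R r) (- aroot R r i r) s <->
    allowable i s by apply: alternationE.
suff bas : is_BAS (highest_root R r) (- aroot R r i r) (@basic_words r i).
  split=> [basS|->//]; apply/seteqP; split.
    exact: BAS_sub basS bas.
  exact: BAS_sub bas basS.
have -> : @basic_words r i = [set b |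
    [/\ alternation (highest_root R r) (- aroot R r i r) b, b != 1%g &
        dynkin_connected (influence b)]].
  apply/seteqP; split=> b.
    move=> /(basic_words_sub hi)[ab b1 cvx]; split=> //; first exact/altE.
    exact: convex_connected.
  move=> [/altE ab b1 con]; apply: allowable_convex_basic => //.
  exact: connected_convex.
apply: BAS_downward_closed => s t /altE[e1 le er] ts; apply/altE; split.
- by have := ts 1%N; lia.
- by move=> k; have := ts k; have := le k; lia.
- by have := ts r; have := ts r.-1; lia.
Qed.
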